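(* There exist a Hilbert space $H$, a generator $A:D(A)\subset H\to H$ of a uniformly exponentially stable analytic semigroup $(e^{tA})_{t\ge0}$ on $H$, and a linear operator $B:D(A)\to H$ that is $\theta$-subordinate to $A$ for some $\theta\in[0,1)$, such that $Be^{tA}$ is not compact for any $t>0$, and $A+B$ generates a $C_0$-semigroup on $H$ that is strongly stable but not uniformly exponentially stable.
   Context: Hilbert spaces are complex. A linear operator $B:D(B)\to H$ is $\theta$-subordinate to $A$ (with $0\le\theta<1$) if $D(A)\subseteq D(B)$ and there is $c>0$ with $\|Bx\|\le c\,\|Ax\|^{\theta}\|x\|^{1-\theta}$ for all $x\in D(A)$ (for $\theta=0$ this reads $\|Bx\|\le c\|x\|$). The operator $A+B$ has domain $D(A)$. A $C_0$-semigroup $(T(t))_{t\ge0}$ is strongly stable if $\lim_{t\to\infty}\|T(t)x\|=0$ for all $x$, and uniformly exponentially stable if there are $M\ge1$, $\omega>0$ with $\|T(t)\|\le Me^{-\omega t}$ for all $t\ge0$. *)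

(* Defs.v *)
From HB Require Import structures.
From mathcomp Require Import all_boot all_order all_algebra.
From mathcomp Require Import sesquilinear complex.
From mathcomp Require Import all_classical all_reals all_analysis.

Set Implicit Arguments.
Unset Strict Implicit.
Unset Printing Implicit Defensive.

Import Order.TTheory GRing.Theory Num.Theory.
Import numFieldNormedType.Exports.

Local Open Scope classical_set_scope.
Local Open Scope ring_scope.
Local Open Scope complex_scope.

(* The inner product is linear in its first argument and conjugate-linear in
   its second one. *)
Record hilbertSpace (R : realType) := HilbertSpace {
  hilbert_sort :> completeNormedModType R[i];
  inner : {dot hilbert_sort for Num.conj};
  inner_norm : forall x : hilbert_sort, `|x| ^+ 2 = inner x x
}.

Section Operators.
Context {R : realType} {H : hilbertSpace R}.

(* The norm `|x| takes its values in R[i]; hnorm x is the same nonnegative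
   number, seen in R. *)
Definition hnorm (x : H) : R := complex.Re `|x|.

Definition opnorm (f : H -> H) : \bar R :=
  ereal_sup [set (hnorm (f x))%:E | x in [set x : H | hnorm x <= 1]].

Definition bounded_op (f : H -> H) : Prop := linear f /\ continuous f.

(* Meant for everywhere defined linear maps. This covers B \o T t for T an
   analytic semigroup generated by A: differentiability of T at t > 0 gives
   range (T t) `<=` dom A. *)
Definition compact_op (f : H -> H) : Prop :=
  precompact (f @` [set x : H | hnorm x <= 1]).

(* A possibly unbounded operator with domain dom; the values of fn outside dom
   are irrelevant. *)
Record linop := Linop {
  dom : set H;
  fn :> H -> H;
  dom0 : dom 0;
  domP : forall (a : R[i]) (x y : H), dom x -> dom y -> dom (a *: x + y);
  fn_linear : forall (a : R[i]) (x y : H), dom x -> dom y ->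
    fn (a *: x + y) = a *: fn x + fn y
}.

Section Add.
Variables A B : linop.

Let add_dom0 : (dom A `&` dom B) 0.
Proof. by split; exact: dom0. Qed.

Let add_domP (a : R[i]) (x y : H) : (dom A `&` dom B) x ->
  (dom A `&` dom B) y -> (dom A `&` dom B) (a *: x + y).
Proof. by move=> [Ax Bx] [Ay By]; split; exact: domP. Qed.

Let add_linear (a : R[i]) (x y : H) : (dom A `&` dom B) x ->
  (dom A `&` dom B) y ->
  A (a *: x + y) + B (a *: x + y) = a *: (A x + B x) + (A y + B y).
Proof. by move=> [Ax Bx] [Ay By]; rewrite !fn_linear// scalerDr addrACA. Qed.

(* The domain is dom A as soon as dom A `<=` dom B. *)
Definition linop_add : linop :=
  @Linop (dom A `&` dom B) (fun x => A x + B x) add_dom0 add_domP add_linear.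

End Add.

(* At theta = 0 the bound reads hnorm (B x) <= c * hnorm x, because
   0 `^ 0 = 1. *)
Definition subordinate (theta : R) (B A : linop) : Prop :=
  dom A `<=` dom B /\
  exists2 c : R, 0 < c & forall x, dom A x ->
    hnorm (B x) <= c * hnorm (A x) `^ theta * hnorm x `^ (1 - theta).

(* Only the values T t with 0 <= t are meaningful. *)
Definition C0_semigroup (T : R -> H -> H) : Prop :=
  [/\ forall t : R, 0 <= t -> bounded_op (T t),
      forall x, T 0 x = x,
      forall (s t : R) x, 0 <= s -> 0 <= t -> T (s + t) x = T s (T t x) &
      forall x, T t x @[t --> 0^'+] --> x].

Definition generates (A : linop) (T : R -> H -> H) : Prop :=
  C0_semigroup T /\
  forall x y : H, (dom A x /\ A x = y) <->
    (t^-1)%:C *: (T t x - x) @[t --> 0^'+] --> y.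

Definition sector (delta : R) : set R[i]^o :=
  [set z | exists r phi : R, [/\ 0 < r, `|phi| < delta &
    z = (r * cos phi) +i* (r * sin phi)]].

(* Complex differentiability at z for the operator norm. *)
Definition op_holomorphic_at (S : R[i]^o -> H -> H) (z : R[i]^o) : Prop :=
  exists2 D : H -> H, bounded_op D &
    opnorm (fun x => h^-1 *: (S (z + h) x - S z x) - D x)
      @[h --> (0 : R[i]^o)^'] --> 0%E.

Definition analytic_semigroup (T : R -> H -> H) : Prop :=
  C0_semigroup T /\
  exists (delta : R) (S : R[i]^o -> H -> H), 0 < delta <= pi / 2 /\
  [/\ forall (t : R) x, 0 <= t -> S t%:C x = T t x,
      forall z, sector delta z -> bounded_op (S z),
      forall z w x, sector delta z -> sector delta w ->
        S (z + w) x = S z (S w x),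
      forall z, sector delta z -> op_holomorphic_at S z &
      forall (delta' : R) x, 0 < delta' < delta ->
        S z x @[z --> within (sector delta') (nbhs (0 : R[i]^o))] --> x].

Definition strongly_stable (T : R -> H -> H) : Prop :=
  forall x, hnorm (T t x) @[t --> +oo] --> (0 : R).

Definition uniformly_exp_stable (T : R -> H -> H) : Prop :=
  exists M omega : R, [/\ 1 <= M, 0 < omega & forall t : R, 0 <= t ->
    (opnorm (T t) <= (M * expR (- (omega * t)))%:E)%E].

End Operators.

Arguments linop {R} H.

(* Main.v *)
From HB Require Import structures.
Require Import Defs.
From mathcomp Require Import all_boot all_order all_algebra.
From mathcomp Require Import sesquilinear complex.
From mathcomp Require Import all_classical all_reals all_analysis.
From mathcomp Require Import ring lra.

(** Take H to be the space of square-summable complex sequences, A = - 1, and B the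
    diagonal operator with entries 1 - 1 / (k + 1). All operators are bounded, hence
    everywhere defined, and theta = 0.

    The semigroup of A is multiplication by exp(- t). It extends to the complex
    plane as z -> exp(- z), which makes it analytic (scalar_sg_analytic), and it
    decays exponentially. The operator B exp(t A) is diagonal with entries
    (1 - 1 / (k + 1)) exp(- t), which do not tend to 0, so it is not compact
    (diag_not_compact).

    The sum A + B is diagonal with entries - 1 / (k + 1): each coordinate decays
    exponentially, but at rates that tend to 0. The semigroup of contractions with
    entries exp(- t / (k + 1)) is therefore strongly stable, by splitting a vector
    into finitely many coordinates and a small tail (diag_sg_strongly_stable); it
    is not uniformly exponentially stable, since its norm is 1 at every time
    (diag_sg_not_exp_stable). Both generation claims are instances of
    diag_sg_generates: a diagonal semigroup with decay rates in [0, 1] is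
    differentiable in operator norm at time 0.

    Half of the work is the construction of the Hilbert space: the inner product as
    a sum of a complex series, the triangle inequality through Cauchy-Schwarz
    (ell2_nsqD_le), and completeness (ell2_complete). *)

Set Implicit Arguments.
Unset Strict Implicit.
Unset Printing Implicit Defensive.

Import Order.TTheory GRing.Theory Num.Theory.
Import numFieldNormedType.Exports.

Local Open Scope classical_set_scope.
Local Open Scope ring_scope.
Local Open Scope complex_scope.

(** * Square-summable complex sequences *)

Section SquareSummable.
Variable R : realType.
Implicit Types (f g h : nat -> R[i]) (u v : nat -> R) (z w : R[i]).

Local Notation Re := (@complex.Re R).
Local Notation Im := (@complex.Im R).

Definition nsq z : R := Re z ^+ 2 + Im z ^+ 2.

Lemma nsq_ge0 z : 0 <= nsq z.
Proof. by rewrite addr_ge0 ?sqr_ge0. Qed.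

Lemma nsq_real (c : R) : nsq c%:C = c ^+ 2.
Proof. by rewrite /nsq/= expr0n addr0. Qed.

Lemma nsq0 : nsq 0 = 0.
Proof. by rewrite nsq_real expr0n. Qed.

Lemma nsq1 : nsq 1 = 1.
Proof. by rewrite nsq_real expr1n. Qed.

Lemma nsqM z w : nsq (z * w) = nsq z * nsq w.
Proof. by case: z w => [a b] [c d]; rewrite /nsq /=; ring. Qed.

(** A parallelogram-type bound; it makes square-summable sequences stable under
    addition without knowing the triangle inequality of the norm. *)
Lemma nsqD_le z w : nsq (z + w) <= 2 * nsq z + 2 * nsq w.
Proof.
case: z w => [a b] [c d]; rewrite /nsq /=.
have := sqr_ge0 (a - c); have := sqr_ge0 (b - d); rewrite !sqrrB !sqrrD; lra.
Qed.

Lemma series_abs_cvg u v : (forall k, `|u k| <= v k) ->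
  cvgn (series v) -> cvgn (series u).
Proof.
move=> uv cv; apply: normed_cvg; apply: (@series_le_cvg _ _ v) => // k.
  exact: normr_ge0.
exact: le_trans (normr_ge0 _) (uv k).
Qed.

Lemma series_ge0_limn_ge u n : (forall k, 0 <= u k) -> cvgn (series u) ->
  series u n <= limn (series u).
Proof.
move=> u0 cu; apply: nondecreasing_cvgn_le cu n.
by apply/nondecreasing_seqP => n; rewrite /series/= big_nat_recr//= lerDl.
Qed.

(** A bound that is uniform in the partial sums gives at once convergence and the
    same bound for the sum. Membership in the sequence space and norm estimates
    are always obtained together in this way. *)
Lemma series_ge0_bounded u M : (forall k, 0 <= u k) ->
  (forall n, series u n <= M) -> cvgn (series u) /\ limn (series u) <= M.
Proof.
move=> u0 uM; have cu : cvgn (series u).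
  apply: nondecreasing_is_cvgn; last by exists M => _ [n _ <-].
  by apply/nondecreasing_seqP => n; rewrite /series/= big_nat_recr//= lerDl.
by split=> //; apply: limr_le => //; apply: nearW.
Qed.

(** Complex series are handled through their real and imaginary parts, where
    monotone and absolute convergence of real series apply. *)
Definition csummable f :=
  cvgn (series (fun k => Re (f k))) /\ cvgn (series (fun k => Im (f k))).

Definition csum f : R[i] :=
  limn (series (fun k => Re (f k))) +i* limn (series (fun k => Im (f k))).

Lemma csum_linear (a : R[i]) f g : csummable f -> csummable g ->
  csum (fun k => a * f k + g k) = a * csum f + csum g.
Proof.
case: a => a b [fr fi] [gr gi]; rewrite /csum.
have -> : (fun k => Re ((a +i* b) * f k + g k)) =
    (a *: (fun k => Re (f k)) - b *: (fun k => Im (f k))) +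
    (fun k => Re (g k)).
  by apply/funext => k; rewrite !fctE /=; case: (f k) (g k) => [? ?] [? ?].
have -> : (fun k => Im ((a +i* b) * f k + g k)) =
    (a *: (fun k => Im (f k)) + b *: (fun k => Re (f k))) +
    (fun k => Im (g k)).
  by apply/funext => k; rewrite !fctE /=; case: (f k) (g k) => [? ?] [? ?].
have Zc (c : R) u : cvgn (series u) -> cvgn (series (c *: u)).
  exact: is_cvg_seriesZ.
rewrite (lim_seriesD _ gr) ?(lim_seriesD _ gi); first last.
- by apply: is_cvg_seriesB; exact: Zc.
- by apply: is_cvg_seriesD; exact: Zc.
rewrite (lim_seriesB (Zc a _ fr) (Zc b _ fi)) (lim_seriesD (Zc a _ fi) (Zc b _ fr)).
by rewrite !lim_seriesZ.
Qed.

Lemma csum_conj f : csummable f -> csum (fun k => (f k)^*) = (csum f)^*.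
Proof.
case=> fr fi; rewrite /csum /=; congr (_ +i* _).
  by congr (limn (series _)); apply/funext => k; case: (f k).
rewrite -lim_seriesN//; congr (limn (series _)).
by apply/funext => k; rewrite fctE; case: (f k).
Qed.

Definition sqsummable : {pred nat -> R[i]} :=
  mem [set f | cvgn (series (fun k => nsq (f k)))].

Lemma sqsummableP f :
  reflect (cvgn (series (fun k => nsq (f k)))) (f \in sqsummable).
Proof. by apply: (iffP idP); rewrite -topredE/= /in_mem/= inE. Qed.

Fact sqsummable_submod : submod_closed sqsummable.
Proof.
split.
  apply/sqsummableP; suff -> : (fun k => nsq ((0 : nat -> R[i]) k)) = cst 0.
    by rewrite (_ : series _ = cst 0) ?funeqE; [exact: is_cvg_cst|
      move=> n; rewrite /series/= big1].
  by apply/funext => k; exact: nsq0.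
move=> a f g /sqsummableP cf /sqsummableP cg; apply/sqsummableP.
apply: (@series_abs_cvg _
  ((2 * nsq a) *: (fun k => nsq (f k)) + (2 : R) *: (fun k => nsq (g k)))).
  move=> k; rewrite !fctE ger0_norm ?nsq_ge0//.
  by apply: le_trans (nsqD_le _ _) _; rewrite nsqM mulrA.
by apply: is_cvg_seriesD; exact: is_cvg_seriesZ.
Qed.

HB.instance Definition _ :=
  GRing.isSubmodClosed.Build R[i] (nat -> R[i]) sqsummable sqsummable_submod.

Lemma summable_mulJ f g : f \in sqsummable -> g \in sqsummable ->
  csummable (fun k => f k * (g k)^*).
Proof.
move=> /sqsummableP cf /sqsummableP cg.
have cfg := is_cvg_seriesD cf cg.
(* Both parts of the product f k * conj (g k) have the form a c + b d. *)
have le4 (a b c d : R) : `|a * c + b * d| <= (a ^+ 2 + b ^+ 2) + (c ^+ 2 + d ^+ 2).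
  rewrite ler_norml; apply/andP; split.
    have := sqr_ge0 (a + c); have := sqr_ge0 (b + d); have := sqr_ge0 a.
    by have := sqr_ge0 b; have := sqr_ge0 c; have := sqr_ge0 d; rewrite !sqrrD; lra.
  have := sqr_ge0 (a - c); have := sqr_ge0 (b - d); have := sqr_ge0 a.
  by have := sqr_ge0 b; have := sqr_ge0 c; have := sqr_ge0 d; rewrite !sqrrB; lra.
split; apply: series_abs_cvg cfg => k; rewrite fctE /nsq;
  case: (f k) (g k) => [a b] [c d] /=.
  by rewrite -mulrN opprK.
by rewrite -(sqrrN d) [X in _ <= _ + X]addrC le4.
Qed.

End SquareSummable.

(** * The complex Hilbert space of square-summable sequences *)

Record ell2 (R : realType) :=
  Ell2 { ell2_val :> nat -> R[i]; _ : ell2_val \in @sqsummable R }.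

HB.instance Definition _ (R : realType) := [isSub of ell2 R for @ell2_val R].
HB.instance Definition _ (R : realType) := [Choice of ell2 R by <:].
HB.instance Definition _ (R : realType) :=
  [SubChoice_isSubLmodule of ell2 R by <:].

Section Ell2Inner.
Variable R : realType.
Implicit Types (x y z : ell2 R) (a : R[i]).

Lemma ell2P x : (x : nat -> R[i]) \in @sqsummable R.
Proof. by case: x. Qed.

Lemma ell2_eq x y : (forall k, x k = y k) -> x = y.
Proof. by move=> xy; apply/val_inj/funext. Qed.

Definition ell2_inner x y : R[i] := csum (fun k => x k * (y k)^*).

Fact ell2_inner_herm x y : ell2_inner x y = (ell2_inner y x)^*.
Proof.
rewrite -csum_conj; last exact: summable_mulJ (ell2P y) (ell2P x).
by congr csum; apply/funext => k; rewrite rmorphM/= conjcK mulrC.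
Qed.

Fact ell2_inner_linearl y a x z :
  ell2_inner (a *: x + z) y = a * ell2_inner x y + ell2_inner z y.
Proof.
rewrite -csum_linear; try exact: summable_mulJ (ell2P _) (ell2P _).
congr csum; apply/funext => k.
by rewrite mulrA -mulrDl.
Qed.

Fact ell2_inner_bilinear : bilinear_for
  (GRing.Scale.Law.clone _ _ *%R _) (GRing.Scale.Law.clone _ _ (Num.conj \; *%R) _)
  ell2_inner.
Proof.
split=> [y a x z|x a y z]; first exact: ell2_inner_linearl.
rewrite ell2_inner_herm ell2_inner_linearl rmorphD rmorphM.
by rewrite (ell2_inner_herm x y) (ell2_inner_herm x z).
Qed.

HB.instance Definition _ :=
  bilinear_isBilinear.Build R[i] (ell2 R) (ell2 R) R[i] _ _ ell2_inner
    ell2_inner_bilinear.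

Fact ell2_inner_hermitian x y :
  ell2_inner x y = (-1) ^+ false * Num.conj (ell2_inner y x).
Proof. by rewrite mul1r ell2_inner_herm. Qed.

HB.instance Definition _ :=
  isHermitianSesquilinear.Build R[i] (ell2 R) false Num.conj ell2_inner
    ell2_inner_hermitian.

(** The squared norm is kept in R, where square roots and the total order are
    available; ell2_norm embeds its root into R[i]. *)
Definition ell2_nsq x : R := limn (series (fun k => nsq (x k))).

Lemma ell2_nsq_cvg x : cvgn (series (fun k => nsq (x k))).
Proof. exact/sqsummableP/ell2P. Qed.

Lemma ell2_nsq_ge x n : \sum_(0 <= k < n) nsq (x k) <= ell2_nsq x.
Proof.
by apply: series_ge0_limn_ge => [k|]; [exact: nsq_ge0|exact: ell2_nsq_cvg].
Qed.

Lemma ell2_coord_le x k : nsq (x k) <= ell2_nsq x.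
Proof.
apply: le_trans (ell2_nsq_ge x k.+1).
by rewrite big_nat_recr//= lerDr sumr_ge0// => *; exact: nsq_ge0.
Qed.

Lemma ell2_nsq_ge0 x : 0 <= ell2_nsq x.
Proof. exact: le_trans (nsq_ge0 (x 0)) (ell2_coord_le x 0). Qed.

Lemma nsq_eq0 (z : R[i]) : nsq z = 0 -> z = 0.
Proof.
case: z => a b /eqP; rewrite /nsq/= paddr_eq0 ?sqr_ge0// !sqrf_eq0.
by move=> /andP[/eqP -> /eqP ->].
Qed.

Lemma ell2_nsq_eq0 x : ell2_nsq x = 0 -> x = 0.
Proof.
move=> x0; apply: ell2_eq => k; apply: nsq_eq0; apply/eqP.
by rewrite eq_le nsq_ge0 andbT -x0 ell2_coord_le.
Qed.

Lemma ell2_inner_nsq x : ell2_inner x x = (ell2_nsq x)%:C.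
Proof.
congr (_ +i* _).
  congr (limn (series _)); apply/funext => k; rewrite /nsq.
  by case: (x k) => a b /=; rewrite mulrN opprK !expr2.
have -> : (fun k => complex.Im (x k * (x k)^*)) = cst 0.
  by apply/funext => k; case: (x k) => a b /=; rewrite mulrN [X in _ + X]mulrC addNr.
rewrite (_ : series _ = cst 0) ?lim_cst//.
by apply/funext => n; rewrite /series/= big1.
Qed.

Fact ell2_inner_gt0 x : x != 0 -> 0 < ell2_inner x x.
Proof.
move=> x0; rewrite ell2_inner_nsq ltcR lt_neqAle ell2_nsq_ge0 andbT.
by apply: contra_neq x0 => /esym /ell2_nsq_eq0.
Qed.

HB.instance Definition _ :=
  isDotProduct.Build R[i] (ell2 R) ell2_inner ell2_inner_gt0.

Local Notation inn := (ell2_inner : {dot (ell2 R) for Num.conj}).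

Lemma ell2_nsqZ a x : ell2_nsq (a *: x) = nsq a * ell2_nsq x.
Proof.
rewrite /ell2_nsq -[RHS](lim_seriesZ (nsq a) (@ell2_nsq_cvg x)).
by congr (limn (series _)); apply/funext => k; exact: nsqM.
Qed.

Lemma ell2_nsqD x y :
  ell2_nsq (x + y) = ell2_nsq x + ell2_nsq y + 2 * complex.Re (ell2_inner x y).
Proof.
apply: complexI; rewrite -ell2_inner_nsq [LHS](dnormD inn x y).
rewrite -[inn x y]/(ell2_inner x y) -[inn x x]/(ell2_inner x x).
rewrite -[inn y y]/(ell2_inner y y) !ell2_inner_nsq.
by case: (ell2_inner x y) => a b; congr (_ +i* _) => /=; ring.
Qed.

Lemma ell2_innerZr (b c : R) x y : complex.Re (ell2_inner (b%:C *: x) (c%:C *: y)) =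
  b * c * complex.Re (ell2_inner x y).
Proof.
rewrite [ell2_inner _ _](linearZl_LR inn) [X in _ * X](linearZr_LR inn).
rewrite -[inn x y]/(ell2_inner x y).
rewrite -[(_ \; _) _ _]/((c%:C)^* * ell2_inner x y).
by case: (ell2_inner x y) => ? ? /=; ring.
Qed.

(** Cauchy-Schwarz for the real part of the inner product, obtained from the
    nonnegativity of the squared norm of |y| x - |x| y. *)
Lemma ell2_nsqD_le x y : ell2_nsq (x + y) <=
  (Num.sqrt (ell2_nsq x) + Num.sqrt (ell2_nsq y)) ^+ 2.
Proof.
rewrite ell2_nsqD sqrrD !sqr_sqrtr ?ell2_nsq_ge0//.
set a := Num.sqrt (ell2_nsq x); set b := Num.sqrt (ell2_nsq y).
set d := complex.Re _.
have a2 : ell2_nsq x = a ^+ 2 by rewrite sqr_sqrtr ?ell2_nsq_ge0.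
have b2 : ell2_nsq y = b ^+ 2 by rewrite sqr_sqrtr ?ell2_nsq_ge0.
(* The vanishing cases are separated because the squared norm of b x - a y
   equals 2 a b (a b - d), which bounds d only when a b > 0. *)
suff : d <= a * b by lra.
have [a0|a_neq0] := eqVneq a 0.
  have x0 : x = 0 by apply: ell2_nsq_eq0; rewrite a2 a0 expr0n.
  by rewrite /d x0 (linear0l inn) a0 mul0r.
have [b0|b_neq0] := eqVneq b 0.
  have y0 : y = 0 by apply: ell2_nsq_eq0; rewrite b2 b0 expr0n.
  by rewrite /d y0 (linear0r inn) b0 mulr0.
have ab0 : 0 < a * b by rewrite mulr_gt0// lt_neqAle eq_sym ?a_neq0 ?b_neq0 sqrtr_ge0.
have := ell2_nsq_ge0 (b%:C *: x + (- a)%:C *: y).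
rewrite ell2_nsqD !ell2_nsqZ a2 b2 ell2_innerZr -/d.
by rewrite /nsq /= !expr0n/= !addr0 => H; rewrite -(ler_pM2l ab0); lra.
Qed.

Definition ell2_norm x : R[i] := (Num.sqrt (ell2_nsq x))%:C.

Fact ell2_normD x y : ell2_norm (x + y) <= ell2_norm x + ell2_norm y.
Proof.
rewrite -rmorphD lecR -[leRHS]ger0_norm ?addr_ge0 ?sqrtr_ge0// -sqrtr_sqr.
exact/ler_wsqrtr/ell2_nsqD_le.
Qed.

Fact ell2_normZ a x : ell2_norm (a *: x) = `|a| * ell2_norm x.
Proof.
by rewrite /ell2_norm ell2_nsqZ sqrtrM ?nsq_ge0// normc_def -rmorphM.
Qed.

Fact ell2_norm_eq0 x : ell2_norm x = 0 -> x = 0.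
Proof.
move=> [/eqP]; rewrite sqrtr_eq0 => x0.
by apply/ell2_nsq_eq0/le_anti; rewrite x0 ell2_nsq_ge0.
Qed.

HB.instance Definition _ := Lmodule_isNormed.Build R[i] (ell2 R)
  ell2_normD ell2_normZ ell2_norm_eq0.

Lemma ell2_normE x : `|x| = (Num.sqrt (ell2_nsq x))%:C.
Proof. by []. Qed.

End Ell2Inner.

Section Ell2Complete.
Variable R : realType.
Implicit Types (x y z : ell2 R).

Lemma ell2_subE x y k : (x - y) k = x k - y k.
Proof. by []. Qed.

Lemma ell2_addE x y k : (x + y) k = x k + y k.
Proof. by []. Qed.

Lemma ell2_scaleE (a : R[i]) x k : (a *: x) k = a * x k.
Proof. by []. Qed.

Lemma ell2_normrE x (e : R) : (`|x| < e%:C) = (Num.sqrt (ell2_nsq x) < e).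
Proof. exact: ltcR. Qed.

Lemma ell2_norm_le x (e : R) : 0 <= e -> ell2_nsq x <= e ^+ 2 -> `|x| <= e%:C.
Proof.
move=> e0 xe; rewrite ell2_normE lecR -[leRHS]ger0_norm// -sqrtr_sqr.
exact: ler_wsqrtr.
Qed.

(** Coordinates are contractions: this transports Cauchy filters to the real line
    for completeness, and gives the lower bounds on norms used later. *)
Lemma ell2_coord_norm x k :
  `|complex.Re (x k)|%:C <= `|x| /\ `|complex.Im (x k)|%:C <= `|x|.
Proof.
have xk := ell2_coord_le x k; rewrite ell2_normE !lecR -!sqrtr_sqr.
by split; apply: ler_wsqrtr; apply: le_trans xk; rewrite ?lerDl ?lerDr sqr_ge0.
Qed.

(** A Cauchy filter converges coordinatewise. If x is within e of the members of
    some set of the filter, then every partial sum of |x - y|^2 is at most e^2 for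
    those y, and this passes to the coordinatewise limit l in place of y because
    the partial sum is finite. Hence x - l, and so l, is square-summable, and x is
    within e of l. *)
Lemma ell2_complete (F : set_system (ell2 R)) :
  ProperFilter F -> cauchy F -> cvg F.
Proof.
move=> FF /cauchyP Fc.
have {}Fc (e : R) : 0 < e -> exists x, F [set y | `|x - y| < e%:C].
  move=> e0; have [|x Fx] := Fc e%:C; first by rewrite ltcR.
  by exists x; move: Fx; rewrite -ball_normE.
have coord_cvg (p : R[i] -> R) :
    {morph p : z w / z - w} -> (forall x k, `|p (x k)|%:C <= `|x|) ->
    forall k, cvg ((fun y : ell2 R => p (y k)) @ F).
  move=> pB pn k; apply/cauchy_cvgP/cauchy_exP => e e0.
  have [x Fx] := Fc _ e0; exists (p (x k)).
  rewrite /nbhs/=; apply: filterS Fx => y /= xy; rewrite -ball_normE/= -pB.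
  rewrite -ltcR; apply: le_lt_trans xy.
  exact: (pn (x - y) k).
have Rcvg k : cvg ((fun y : ell2 R => complex.Re (y k)) @ F).
  apply: coord_cvg => [[? ?] [? ?]//|x j]; exact: (ell2_coord_norm x j).1.
have Icvg k : cvg ((fun y : ell2 R => complex.Im (y k)) @ F).
  apply: coord_cvg => [[? ?] [? ?]//|x j]; exact: (ell2_coord_norm x j).2.
pose l k := lim ((fun y : ell2 R => complex.Re (y k)) @ F) +i*
            lim ((fun y : ell2 R => complex.Im (y k)) @ F).
have sq_cvg (a b : R) (p : ell2 R -> R) :
    p @ F --> b -> (fun y => (a - p y) ^+ 2) @ F --> (a - b) ^+ 2.
  move=> pb; have apb : (fun y => a - p y) @ F --> a - b.
    by apply: cvgB => //; exact: cvg_cst.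
  rewrite expr2; under eq_fun do rewrite expr2.
  exact: (cvgM apb apb).
have sum_le (e : R) x : F [set y | `|x - y| < e%:C] -> forall n,
    \sum_(0 <= k < n) nsq (x k - l k) <= e ^+ 2.
  move=> Fx n.
  have c : (fun y : ell2 R => \sum_(0 <= k < n) nsq (x k - y k)) @ F -->
      \sum_(0 <= k < n) nsq (x k - l k).
    apply: cvg_big => [|k _ /=]; first exact: add_continuous.
    have -> : (fun y : ell2 R => nsq (x k - y k)) = (fun y : ell2 R =>
        (complex.Re (x k) - complex.Re (y k)) ^+ 2 +
        (complex.Im (x k) - complex.Im (y k)) ^+ 2).
      by apply/funext => y; case: (x k) (y k) => [? ?] [? ?].
    have -> : nsq (x k - l k) = (complex.Re (x k) - complex.Re (l k)) ^+ 2 +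
         (complex.Im (x k) - complex.Im (l k)) ^+ 2.
      by case: (x k) (l k) => [? ?] [? ?].
    by apply: cvgD; apply: sq_cvg; [exact: Rcvg|exact: Icvg].
  rewrite -(cvg_lim _ c)//; apply: limr_le; first by apply/cvg_ex; eexists; exact: c.
  apply: filterS Fx => y /= xy.
  have : \sum_(0 <= k < n) nsq (x k - y k) <= ell2_nsq (x - y).
    rewrite (eq_bigr (fun k => nsq ((x - y) k))) => [|k _]; last by rewrite ell2_subE.
    exact: ell2_nsq_ge.
  move=> /le_trans; apply.
  move: xy; rewrite ell2_normrE => /ltW xy.
  rewrite -[leLHS]sqr_sqrtr ?ell2_nsq_ge0//.
  by rewrite ler_pXn2r// nnegrE ?sqrtr_ge0// (le_trans _ xy)// sqrtr_ge0.
have diff_in (e : R) x : F [set y | `|x - y| < e%:C] ->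
    (fun k => x k - l k) \in @sqsummable R /\
    limn (series (fun k => nsq (x k - l k))) <= e ^+ 2.
  move=> Fx; have [] := series_ge0_bounded (fun k => nsq_ge0 (x k - l k)) (sum_le _ _ Fx).
  by move=> c lc; split=> //; exact/sqsummableP.
have l_in : l \in @sqsummable R.
  have [x Fx] := Fc 1 ltr01; have [d _] := diff_in _ _ Fx.
  rewrite (_ : l = (x : nat -> R[i]) - (fun k => x k - l k)).
    by rewrite rpredB// ell2P.
  by apply/funext => k; rewrite !fctE opprB addrC subrK.
apply/cvg_ex; exists (Ell2 l_in).
apply/cvgrPdist_lt => -[e e']; rewrite ltcE/= => /andP[/eqP -> e0].
have e20 : 0 < e / 2 by rewrite divr_gt0.
have [x Fx] := Fc _ e20; have [_ xl] := diff_in _ _ Fx.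
apply: filterS Fx => y /= xy.
rewrite -[_ - y](subrKA x) (splitr e) -[_ +i* 0]/(e / 2 + e / 2)%:C rmorphD.
apply: le_lt_trans (ler_normD _ _) _; apply: ler_ltD => //.
by rewrite distrC; apply: ell2_norm_le => //; exact: ltW.
Qed.

HB.instance Definition _ := Uniform_isComplete.Build (ell2 R) ell2_complete.

Fact ell2_inner_norm x : `|x| ^+ 2 = ell2_inner x x.
Proof.
by rewrite ell2_normE -rmorphXn/= sqr_sqrtr ?ell2_nsq_ge0// ell2_inner_nsq.
Qed.

Definition ell2_hilbert : hilbertSpace R :=
  @HilbertSpace R (ell2 R) (@ell2_inner R) ell2_inner_norm.

End Ell2Complete.

(** * Real-valued norms and bounded operators *)

Section HilbertNorm.
Variables (R : realType) (H : hilbertSpace R).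
Implicit Types (x y : H) (a : R[i]) (f : H -> H).

(** The modulus as an element of R; the norm of R[i] takes values in R[i]. *)
Definition cabs a : R := complex.Re `|a|.

Lemma cabsE a : `|a| = (cabs a)%:C.
Proof. by rewrite /cabs normc_def. Qed.

Lemma hnormE x : `|x| = (hnorm x)%:C.
Proof. by rewrite /hnorm RRe_real// normr_real. Qed.

Lemma hnorm_ge0 x : 0 <= hnorm x.
Proof. by rewrite -ler0c -hnormE normr_ge0. Qed.

Lemma cabs_ge0 a : 0 <= cabs a.
Proof. by rewrite -ler0c -cabsE normr_ge0. Qed.

Lemma hnormZ a x : hnorm (a *: x) = cabs a * hnorm x.
Proof. by apply: complexI; rewrite -hnormE normrZ rmorphM/= hnormE cabsE. Qed.

Lemma cvg_hnorm (T : Type) (F : set_system T) (f : T -> H) (l : H) :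
  Filter F -> hnorm (f t - l) @[t --> F] --> (0 : R) -> f t @[t --> F] --> l.
Proof.
move=> FF /cvgr0Pnorm_lt fl; apply/cvgrPdist_lt => -[e e'].
rewrite ltcE/= => /andP[/eqP -> e0]; apply: filterS (fl e e0) => t /=.
by rewrite ger0_norm ?hnorm_ge0// distrC hnormE -ltcR.
Qed.

(** Applied with x a cluster point of the images of the unit vectors under a
    diagonal operator: two of these images would be closer than they can be. *)
Lemma hnorm_dist_lt x y z (m : R) :
  `|x - y| < (m / 2)%:C -> `|x - z| < (m / 2)%:C -> hnorm (y - z) < m.
Proof.
rewrite !hnormE !ltcR => xy xz; rewrite -ltcR -hnormE -(subrKA x).
apply: le_lt_trans (ler_normD _ _) _.
by rewrite distrC !hnormE -rmorphD ltcR (splitr m) ltrD.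
Qed.

Lemma bounded_op_le f (M : R) : linear f ->
  (forall x, hnorm (f x) <= M * hnorm x) -> bounded_op f.
Proof.
move=> fl fM; split=> // x; apply: cvg_hnorm.
have fB y : f y - f x = f (y - x).
  by rewrite addrC -scaleN1r -fl scaleN1r addrC.
apply: (@squeeze_cvgr _ _ _ _ (cst 0) (fun y => M * hnorm (y - x))).
- by apply: nearW => y; rewrite hnorm_ge0 fB fM.
- exact: cvg_cst.
- rewrite -(mulr0 M); apply: cvgMr; apply/cvgr0Pnorm_lt => e e0.
  have : \forall y \near x, `|x - y| < e%:C.
    by apply: cvgr_dist_lt; [exact: cvg_id|rewrite ltcR].
  by apply: filterS => y; rewrite distrC hnormE ltcR ger0_norm ?hnorm_ge0.
Qed.

Lemma opnorm_le f (M : R) : 0 <= M ->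
  (forall x, hnorm (f x) <= M * hnorm x) -> (opnorm f <= M%:E)%E.
Proof.
move=> M0 fM; apply: ge_ereal_sup => _ [x /= x1 <-].
by rewrite lee_fin (le_trans (fM x))// ler_piMr.
Qed.

Lemma opnorm_ge f x : hnorm x <= 1 -> ((hnorm (f x))%:E <= opnorm f)%E.
Proof. by move=> x1; apply: ereal_sup_ubound; exists x. Qed.

Lemma opnorm_ge0 f : (0 <= opnorm f)%E.
Proof.
have h0 : hnorm (0 : H) <= 1 by rewrite /hnorm normr0 ler01.
by apply: le_trans (opnorm_ge f h0); rewrite lee_fin hnorm_ge0.
Qed.

End HilbertNorm.

(** * Diagonal operators and the semigroups they generate *)

Section Diagonal.
Variable R : realType.
Implicit Types (x y : ell2 R) (d e : nat -> R).

Local Notation H := (ell2_hilbert R).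
Local Notation hn := (@hnorm R H).

(** The default value 0 is taken only when the product sequence is not
    square-summable; for a bounded symbol d this never happens, see diagE. *)
Definition diag d x : ell2 R := insubd (0 : ell2 R) (fun k => (d k)%:C * x k).

Lemma diag_sqsummable d M x : (forall k, `|d k| <= M) ->
  (fun k => (d k)%:C * x k) \in @sqsummable R /\
  limn (series (fun k => nsq ((d k)%:C * x k))) <= M ^+ 2 * ell2_nsq x.
Proof.
move=> dM; have M0 : 0 <= M by rewrite (le_trans _ (dM 0%N)).
have [||c lc] := @series_ge0_bounded R (fun k => nsq ((d k)%:C * x k))
    (M ^+ 2 * ell2_nsq x).
- by move=> k; exact: nsq_ge0.
- move=> n; apply: (@le_trans _ _ (M ^+ 2 * \sum_(0 <= k < n) nsq (x k))).
    rewrite mulr_sumr; apply: ler_sum => k _.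
    rewrite nsqM nsq_real ler_wpM2r ?nsq_ge0// -(ger0_norm (sqr_ge0 _)) normrX.
    by rewrite ler_pXn2r.
  by rewrite ler_wpM2l ?sqr_ge0// ell2_nsq_ge.
by split=> //; exact/sqsummableP.
Qed.

Lemma diagE d M x k : (forall k, `|d k| <= M) -> diag d x k = (d k)%:C * x k.
Proof. by move=> dM; rewrite /diag insubdK//; have [] := diag_sqsummable x dM. Qed.

Lemma diag_nsq d M x : (forall k, `|d k| <= M) ->
  ell2_nsq (diag d x) = limn (series (fun k => d k ^+ 2 * nsq (x k))).
Proof.
move=> dM; congr (limn (series _)); apply/funext => k.
by rewrite (diagE _ _ dM) nsqM nsq_real.
Qed.

Lemma diag_hnorm d M x : (forall k, `|d k| <= M) -> hn (diag d x) <= M * hn x.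
Proof.
move=> dM; have M0 : 0 <= M by rewrite (le_trans _ (dM 0%N)).
have -> : M * hn x = Num.sqrt (M ^+ 2 * ell2_nsq x).
  by rewrite sqrtrM ?sqr_ge0// sqrtr_sqr ger0_norm.
apply: ler_wsqrtr; rewrite (diag_nsq _ dM).
have [_] := diag_sqsummable x dM.
by under eq_fun do rewrite nsqM nsq_real.
Qed.

Lemma diag_lin d M : (forall k, `|d k| <= M) ->
  forall (a : R[i]) x y, diag d (a *: x + y) = a *: diag d x + diag d y.
Proof.
move=> dM a x y; apply: ell2_eq => k.
rewrite !(ell2_addE, ell2_scaleE) !(diagE _ _ dM) !(ell2_addE, ell2_scaleE).
by rewrite mulrDr mulrCA.
Qed.

Lemma diag_bounded d M : (forall k, `|d k| <= M) -> @bounded_op R H (diag d).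
Proof.
move=> dM; apply: (@bounded_op_le R H _ M) => [a x y|x]; first exact: diag_lin dM _ _ _.
exact: diag_hnorm.
Qed.

Lemma diagB d e M x : (forall k, `|d k| <= M) -> (forall k, `|e k| <= M) ->
  diag d x - diag e x = diag (fun k => d k - e k) x.
Proof.
move=> dM eM; have deM k : `|d k - e k| <= M + M.
  by rewrite (le_trans (ler_normB _ _))// lerD.
apply: ell2_eq => k; rewrite ell2_subE (diagE _ _ dM) (diagE _ _ eM) (diagE _ _ deM).
by rewrite -mulrBl -rmorphB.
Qed.

Lemma diagZ d M (c : R) x : (forall k, `|d k| <= M) ->
  c%:C *: diag d x = diag (fun k => c * d k) x.
Proof.
move=> dM; have cdM k : `|c * d k| <= `|c| * M by rewrite normrM ler_wpM2l.
apply: ell2_eq => k; rewrite ell2_scaleE.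
by rewrite (diagE _ _ dM) (diagE _ _ cdM) mulrA -rmorphM.
Qed.

Lemma diagM d e M x : (forall k, `|d k| <= M) -> (forall k, `|e k| <= M) ->
  diag d (diag e x) = diag (fun k => d k * e k) x.
Proof.
move=> dM eM; have deM k : `|d k * e k| <= M * M by rewrite normrM ler_pM.
apply: ell2_eq => k; rewrite (diagE _ _ dM) (diagE _ _ eM) (diagE _ _ deM).
by rewrite mulrA -rmorphM.
Qed.

Lemma diag1 x : diag (fun=> 1) x = x.
Proof.
have b1 (k : nat) : `|(1 : R)| <= 1 by rewrite normr1.
by apply: ell2_eq => k; rewrite (diagE _ _ b1) mul1r.
Qed.

Lemma diag_const (c : R) x : diag (fun=> c) x = c%:C *: x.
Proof.
apply: ell2_eq => k; rewrite (@diagE _ `|c|)//.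
Qed.

Section DiagonalOperator.
Variables (d : nat -> R) (M : R).
Hypothesis dM : forall k, `|d k| <= M.

Let diagop_lin (a : R[i]) (x y : H) : setT x -> setT y ->
  diag d (a *: x + y) = a *: (diag d x : H) + diag d y.
Proof. by move=> _ _; exact: diag_lin dM _ _ _. Qed.

Definition diagop : linop H :=
  @Linop R H setT (diag d) I (fun _ _ _ _ _ => I) diagop_lin.

End DiagonalOperator.

(** The semigroup generated by the diagonal operator with symbol - a. *)
Definition diag_sg (a : nat -> R) (t : R) x : ell2 R :=
  diag (fun k => expR (- (t * a k))) x.

Section DiagonalSemigroup.
Variable a : nat -> R.
Hypothesis a01 : forall k, 0 <= a k <= 1.

Lemma exp_decay_bound (t : R) k : 0 <= t -> `|expR (- (t * a k))| <= 1.
Proof.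
move=> t0; have /andP[a0 _] := a01 k.
by rewrite ger0_norm ?expR_ge0// -expR0 ler_expR oppr_le0 mulr_ge0.
Qed.

(** The upper bound comes from exp(-s) <= 1 / (1 + s) <= 1 - s + s^2, which avoids
    any remainder formula. *)
Lemma expRN_taylor (s : R) : 0 <= s -> 0 <= expR (- s) - 1 + s <= s ^+ 2.
Proof.
move=> s0; have s1 : 0 < 1 + s by lra.
have := expR_ge1Dx (- s) => lb.
have ub : expR (- s) * (1 + s) <= 1.
  rewrite expRN mulrC ler_pdivrMr ?expR_gt0// mul1r; exact: expR_ge1Dx.
apply/andP; split; first lra.
rewrite -(ler_pM2r s1); have : 0 <= s * s ^+ 2 by rewrite mulr_ge0 ?sqr_ge0.
lra.
Qed.

Lemma opp_coeff_bound k : `|- a k| <= 1.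
Proof. by rewrite normrN ger0_norm; case/andP: (a01 k). Qed.

Lemma diag_sg_increment (t : R) x : 0 <= t -> hn (diag_sg a t x - x) <= t * hn x.
Proof.
move=> t0; have b1 (k : nat) : `|(1 : R)| <= 1 by rewrite normr1.
rewrite -[X in _ - X]diag1 (diagB _ (fun k => exp_decay_bound k t0) b1).
apply: diag_hnorm => k; have /andP[a0 a1] := a01 k.
have ta0 : 0 <= t * a k by rewrite mulr_ge0.
have := expR_ge1Dx (- (t * a k)).
have : expR (- (t * a k)) <= 1 by rewrite -expR0 ler_expR oppr_le0.
have : t * a k <= t by rewrite ler_piMr.
by move=> {b1} h1 h2 h3; rewrite ler_norml; apply/andP; split; lra.
Qed.

Lemma cvg_mulr_at0 (c : R) : t * c @[t --> 0^'+] --> (0 : R).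
Proof.
have {2}-> : 0 = 0 * c by rewrite mul0r.
by apply: cvgMl; apply: cvg_at_right_filter; exact: cvg_id.
Qed.

Lemma diag_sg_C0 : @C0_semigroup R H (diag_sg a).
Proof.
split.
- move=> t t0; exact: diag_bounded (fun k => exp_decay_bound k t0).
- move=> x; rewrite /diag_sg (_ : (fun k => _) = (fun=> 1)) ?diag1//.
  by apply/funext => k; rewrite mul0r oppr0 expR0.
- move=> s t x s0 t0; rewrite /diag_sg.
  rewrite (diagM _ (fun k => exp_decay_bound k s0) (fun k => exp_decay_bound k t0)).
  by congr (diag _ x); apply/funext => k; rewrite mulrDl opprD expRD.
- move=> x; apply: cvg_hnorm.
  apply: (@squeeze_cvgr _ _ _ _ (cst 0) (fun t : R => t * hn x)).
  + near=> t; rewrite hnorm_ge0/=; apply/diag_sg_increment/ltW.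
    by near: t; exact: nbhs_right_gt.
  + exact: cvg_cst.
  + exact: cvg_mulr_at0.
Unshelve. all: by end_near. Qed.

(** The estimate |(exp(-t a) - 1) / t + a| <= t a^2 <= t is uniform in the diagonal
    entry a, so that the difference quotient converges in operator norm. *)
Lemma diag_sg_diff_quotient (t : R) x : 0 < t ->
  hn (t^-1%:C *: (diag_sg a t x - x) - diag (fun k => - a k) x) <= t * hn x.
Proof.
move=> t0; have b1 (k : nat) : `|(1 : R)| <= 1 by rewrite normr1.
have t0' := ltW t0.
rewrite -[X in _ *: (_ - X)]diag1 (diagB _ (fun k => exp_decay_bound k t0') b1).
have b2 k : `|expR (- (t * a k)) - 1| <= 1 + 1.
  by rewrite (le_trans (ler_normB _ _))// lerD// ?normr1// exp_decay_bound.
rewrite (diagZ _ _ b2).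
have b3 k : `|t^-1 * (expR (- (t * a k)) - 1)| <= `|t^-1| * (1 + 1) + 1.
  by rewrite normrM ler_wpDr// ler_wpM2l.
have b4 k : `|- a k| <= `|t^-1| * (1 + 1) + 1.
  by rewrite (le_trans (opp_coeff_bound k))// lerDr mulr_ge0.
rewrite (diagB _ b3 b4); apply: diag_hnorm => k; have /andP[a0 a1] := a01 k.
have ta0 : 0 <= t * a k by rewrite mulr_ge0.
have /andP[lo hi] := expRN_taylor ta0.
rewrite opprK -[X in _ + X](mulKf (lt0r_neq0 t0)) -mulrDr ger0_norm.
  rewrite mulrC ler_pdivrMr// (le_trans hi)// exprMn -expr2 ler_piMr ?sqr_ge0//.
  by rewrite expr_le1.
by rewrite mulr_ge0// invr_ge0.
Qed.

(** Since the difference quotient converges at every vector, the generator is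
    everywhere defined, and uniqueness of limits identifies its values. *)
Lemma diag_sg_generates M (aM : forall k, `|- a k| <= M) :
  @generates R H (diagop aM) (diag_sg a).
Proof.
split=> [|x y]; first exact: diag_sg_C0.
have gen : (t^-1)%:C *: (diag_sg a t x - x : H) @[t --> 0^'+] -->
    (diag (fun k => - a k) x : H).
  apply: cvg_hnorm.
  apply: (@squeeze_cvgr _ _ _ _ (cst 0) (fun t : R => t * hn x)).
  - near=> t; rewrite hnorm_ge0/=; apply: diag_sg_diff_quotient.
    by near: t; exact: nbhs_right_gt.
  - exact: cvg_cst.
  - exact: cvg_mulr_at0.
split=> [[_ <-]//|yl]; split=> //.
exact: (@cvg_unique _ (@norm_hausdorff _ H) _ _ _ _ gen yl).
Unshelve. all: by end_near. Qed.

End DiagonalSemigroup.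
End Diagonal.

(** * Compactness and stability of diagonal operators *)

Section DiagonalStability.
Variable R : realType.
Implicit Types (x y : ell2 R) (c a : nat -> R).

Local Notation H := (ell2_hilbert R).
Local Notation hn := (@hnorm R H).

Lemma hn_sqr x : hn x ^+ 2 = ell2_nsq x.
Proof. by rewrite sqr_sqrtr ?ell2_nsq_ge0. Qed.

Lemma coord_hn x k : `|complex.Re (x k)| <= hn x.
Proof. by rewrite -lecR; have [] := ell2_coord_norm x k. Qed.

Lemma delta_sum (k n : nat) :
  \sum_(0 <= j < n) nsq ((j == k)%:R : R[i]) = (k < n)%N%:R :> R.
Proof.
elim: n => [|n IH]; first by rewrite big_nil.
rewrite big_nat_recr//= IH [in RHS]ltnS [in RHS]leq_eqVlt (eq_sym n).
case: eqVneq => [->|_] /=; last by rewrite nsq0 addr0.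
by rewrite ltnn nsq1 add0r.
Qed.

Lemma delta_nsq (k : nat) :
  cvgn (series (fun j => nsq ((j == k)%:R : R[i]))) /\
  limn (series (fun j => nsq ((j == k)%:R : R[i]))) <= 1.
Proof.
apply: series_ge0_bounded => [j|n]; first exact: nsq_ge0.
by rewrite /series/= delta_sum; case: (k < n)%N.
Qed.

Definition unit_vec (k : nat) : ell2 R := insubd (0 : ell2 R) (fun j => (j == k)%:R).

Lemma unit_vecE k j : unit_vec k j = (j == k)%:R.
Proof. by rewrite /unit_vec insubdK//; apply/sqsummableP; exact: (delta_nsq k).1. Qed.

Lemma unit_vec_hn k : hn (unit_vec k) <= 1.
Proof.
rewrite -[leRHS]sqrtr1; apply: ler_wsqrtr; rewrite /ell2_nsq.
under eq_fun do rewrite unit_vecE.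
exact: (delta_nsq k).2.
Qed.

(** The images of distinct unit vectors of large index are m-separated: their
    difference has n-th coordinate c n. A precompact set would give this sequence
    of images a cluster point, with two of its terms within m / 2 of it. *)
Lemma diag_not_compact c (M m : R) : (forall k, `|c k| <= M) -> 0 < m ->
  (\forall k \near \oo, m <= `|c k|) -> ~ @compact_op R H (diag c).
Proof.
move=> cM m0 [N _ mc]; rewrite /compact_op precompactE => Kc.
pose u n : H := diag c (unit_vec n).
have [|p [_ up]] := Kc (u @ \oo) _ _.
  exists 0%N => // n _; apply: subset_closure.
  by exists (unit_vec n) => //; exact: unit_vec_hn.
have m2 : 0 < (m / 2)%:C by rewrite ltcR divr_gt0.
have Bp := nbhsx_ballx p _ m2.
have far N1 : exists2 n, (N1 <= n)%N & `|p - u n| < (m / 2)%:C.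
  have uN1 : (u @ \oo) [set u n | n in [set n | (N1 <= n)%N]].
    by exists N1 => // n /= N1n; exists n.
  have [q [[n /= N1n <-]]] := up _ _ uN1 Bp.
  by rewrite -ball_normE; exists n.
have [n Nn pn] := far N; have [n' nn' pn'] := far n.+1.
have := hnorm_dist_lt pn pn'; rewrite ltNge => /negP; apply.
have coordE : complex.Re ((diag c (unit_vec n) - diag c (unit_vec n')) n) = c n.
  have diag_sub x y k : (diag c x - diag c y) k = (c k)%:C * (x k - y k).
    by rewrite ell2_subE !(diagE _ _ cM) mulrBr.
  by rewrite diag_sub (unit_vecE n) (unit_vecE n') eqxx (ltn_eqF nn') subr0 mulr1.
by apply: le_trans (mc n Nn) _; rewrite -coordE; exact: coord_hn.
Qed.

Section Stability.
Variable a : nat -> R.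
Hypothesis a01 : forall k, 0 <= a k <= 1.

(** On the k-th unit vector the semigroup decays only like exp(-t a k). If a k is
    at most w / 2, a bound M exp(-w t) would give exp(t w / 2) <= M for all t;
    the time t = 2 M / w contradicts exp(M) >= 1 + M. *)
Lemma diag_sg_not_exp_stable : (forall e, 0 < e -> exists k, a k <= e) ->
  ~ @uniformly_exp_stable R H (diag_sg a).
Proof.
move=> a0 [M [w [M1 w0 TM]]].
have [k ak] := a0 (w / 2) (divr_gt0 w0 (ltr0Sn _ 1)).
pose t := 2 * M / w.
have t0 : 0 <= t by rewrite divr_ge0 ?ltW// mulr_gt0// (lt_le_trans _ M1).
have := le_trans (opnorm_ge (diag_sg a t : H -> H) (unit_vec_hn k)) (TM t t0).
rewrite lee_fin => /(le_trans (coord_hn _ k)).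
rewrite (diagE _ _ (fun j => exp_decay_bound a01 j t0)) unit_vecE eqxx mulr1/=.
rewrite ger0_norm ?expR_ge0// => le1.
have wt : w * t = M + M by rewrite /t mulrC divfK ?gt_eqF// mulrDl mul1r.
have ta : t * a k <= M.
  rewrite (le_trans (ler_wpM2l t0 ak))// mulrCA mulrA -mulrA mulrC.
  by have := wt; lra.
have : expR (- M) <= M * expR (- (M + M)).
  by rewrite -wt (le_trans _ le1)// ler_expR lerN2.
rewrite opprD expRD mulrA ler_pMl ?expR_gt0//.
rewrite expRN ler_pdivlMr ?expR_gt0// mul1r leNgt => /negP; apply.
by have := expR_ge1Dx M; lra.
Qed.

(** The first N coordinates are kept with their decay factors, the others are
    bounded by their initial values: the tail is then small uniformly in t. *)
Lemma diag_sg_nsq_head_tail (t : R) x N : 0 <= t -> ell2_nsq (diag_sg a t x) <=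
  \sum_(0 <= k < N) (expR (- (t * a k))) ^+ 2 * nsq (x k) +
  (ell2_nsq x - \sum_(0 <= k < N) nsq (x k)).
Proof.
move=> t0; have b := fun j => exp_decay_bound a01 j t0.
have := @ell2_nsq_cvg R (diag_sg a t x).
rewrite [ell2_nsq (diag_sg _ _ _)](diag_nsq _ b).
under eq_fun do rewrite (diagE _ _ b) nsqM nsq_real.
move=> c; apply: limr_le => //; exists N => // n /= Nn.
rewrite /series/= (@big_cat_nat _ _ _ N)//= lerD2l lerBrDl.
apply: le_trans (ell2_nsq_ge x n); rewrite [leRHS](@big_cat_nat _ _ _ N)//= lerD2l.
apply: ler_sum => k _; rewrite ler_piMl ?nsq_ge0//.
by rewrite expr_le1 ?expR_ge0// (le_trans (ler_norm _)).
Qed.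

Lemma cvg_expRN_pinfty (s : R) : 0 < s -> expR (- (t * s)) @[t --> +oo] --> (0 : R).
Proof.
move=> s0; have ts : t * s @[t --> +oo] --> +oo by exact: gt0_cvgMly.
apply: (@cvg_comp _ _ _ (fun t => t * s) (fun u => expR (- u)) _ _ _ ts).
exact: cvgr_expR.
Qed.

(** N is chosen to make the tail small; the remaining finite sum of decaying
    exponentials tends to 0. *)
Lemma diag_sg_strongly_stable : (forall k, 0 < a k) -> @strongly_stable R H (diag_sg a).
Proof.
move=> a_gt0 x; apply/cvgr0Pnorm_lt => e e0.
have e2 : 0 < e ^+ 2 / 2 by rewrite divr_gt0// exprn_gt0.
have [N _ /(_ N (leqnn N)) /= tailN] :=
  (@cvgr_dist_lt _ _ _ _ _ _ _ (@ell2_nsq_cvg R x) _ e2).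
have head : \sum_(0 <= k < N) (expR (- (t * a k))) ^+ 2 * nsq (x k)
    @[t --> +oo] --> (0 : R).
  have sum0 : \sum_(0 <= k < N) (0 * 0 * nsq (x k)) = 0 :> R.
    by rewrite big1// => k _; rewrite !mul0r.
  rewrite -[X in _ --> X]sum0; apply: cvg_big => [|k _ /=]; first exact: add_continuous.
  by apply: cvgMl; apply: cvgM; exact: cvg_expRN_pinfty.
near=> t.
have t0 : 0 <= t by near: t; exact: nbhs_pinfty_ge.
rewrite ger0_norm ?hnorm_ge0// -(ltr_pXn2r (n := 2))// ?nnegrE ?hnorm_ge0 ?ltW//.
rewrite hn_sqr (le_lt_trans (diag_sg_nsq_head_tail x N t0))// (splitr (e ^+ 2)) ltrD//.
  near: t; move/cvgr0Pnorm_lt: head => /(_ _ e2); apply: filterS => t.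
  exact: le_lt_trans (ler_norm _).
exact: le_lt_trans (ler_norm _) tailN.
Unshelve. all: by end_near. Qed.

End Stability.
End DiagonalStability.

(** * The complex exponential near the origin *)

Section ComplexExponential.
Variable R : realType.
Implicit Types (z w h : R[i]) (a b e : R).

Lemma cabsD z w : cabs (z + w) <= cabs z + cabs w.
Proof. by rewrite -lecR rmorphD -!cabsE ler_normD. Qed.

Lemma cabsM z w : cabs (z * w) = cabs z * cabs w.
Proof. by apply: complexI; rewrite rmorphM -!cabsE normrM. Qed.

Lemma cabs_le a b : cabs (a +i* b) <= `|a| + `|b|.
Proof.
rewrite -lecR -cabsE normc_def lecR /= -[leRHS]ger0_norm ?addr_ge0//.
rewrite -sqrtr_sqr; apply: ler_wsqrtr; rewrite sqrrD !real_normK ?num_real//.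
by rewrite lerD2r lerDl mulrn_wge0// mulr_ge0.
Qed.

Lemma Re_le_cabs z : `|complex.Re z| <= cabs z.
Proof.
rewrite -lecR -cabsE normc_def lecR -sqrtr_sqr; apply: ler_wsqrtr.
by rewrite lerDl sqr_ge0.
Qed.

Lemma Im_le_cabs z : `|complex.Im z| <= cabs z.
Proof.
rewrite -lecR -cabsE normc_def lecR -sqrtr_sqr; apply: ler_wsqrtr.
by rewrite lerDr sqr_ge0.
Qed.

(** Euler's formula serves as the definition, so that the addition formula and the
    behaviour at 0 reduce to real exponential, sine and cosine. *)
Definition cexp z : R[i] :=
  (expR (complex.Re z) * cos (complex.Im z)) +i*
  (expR (complex.Re z) * sin (complex.Im z)).

Lemma cexpD z w : cexp (z + w) = cexp z * cexp w.
Proof.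
case: z w => [a b] [c d]; rewrite /cexp /= expRD cosD sinD.
by congr (_ +i* _); ring.
Qed.

Lemma cexp_real a : cexp a%:C = (expR a)%:C.
Proof. by rewrite /cexp /= cos0 sin0 mulr1 mulr0. Qed.

Lemma near0_cabs e : 0 < e -> \forall h \near (0 : R[i]^o), cabs h < e.
Proof.
move=> e0; apply/nbhs_ballP; exists e%:C => /=; first by rewrite ltcR.
by move=> h; rewrite -ball_normE/= sub0r normrN cabsE ltcR.
Qed.

(** The opposite signs are those needed for cexp (- h). *)
Lemma near0_opp_ReIm (P : R -> Prop) : (\forall b \near (0 : R), P b) ->
  \forall h \near (0 : R[i]^o), P (- complex.Re h) /\ P (- complex.Im h).
Proof.
move=> /nbhs_ballP[e /= e0 eP]; apply: filterS (near0_cabs e0) => h he.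
split; apply: eP; rewrite -ball_normE/= sub0r opprK.
  exact: le_lt_trans (Re_le_cabs h) he.
exact: le_lt_trans (Im_le_cabs h) he.
Qed.

Lemma is_derive_near0 (f : R -> R) (d e : R) : is_derive (0 : R) (1 : R) f d -> 0 < e ->
  \forall b \near (0 : R), `|f b - f 0 - d * b| <= e * `|b|.
Proof.
move=> [df <-] e0.
have /cvgrPdist_le/(_ e e0) := df.
rewrite near_withinE; apply: filterS => b /= fb.
have [->|b0] := eqVneq b 0; first by rewrite mulr0 subr0 subrr !normr0 mulr0.
move: (fb b0); rewrite scaler1 addr0 -/(derive f 0 1) => {}fb.
rewrite -ler_pdivrMr ?normr_gt0// -normrV ?unitfE// -normrM distrC in fb *.
apply: le_trans fb; rewrite le_eqVlt; apply/orP; left; apply/eqP; congr `|_|.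
by rewrite -[_ *: _]/(_ * _); field.
Qed.

(** The derivative of exp(- h) at 0 is - 1. With h = p + i q, the real and
    imaginary parts of the remainder are split as
    E (C - 1) + (E - 1 + p) and E (S + q) + (1 - E) q, where E = exp(-p),
    C = cos(-q), S = sin(-q); each term is small compared with |p| + |q|. *)
Lemma cexpN_taylor e : 0 < e ->
  \forall h \near (0 : R[i]^o), cabs (cexp (- h) - 1 + h) <= e * cabs h.
Proof.
(* Assuming e <= 1 gives the bound E <= 2 used for both products. *)
wlog e1 : e / e <= 1.
  move=> H e0; have : 0 < Num.min e 1 by rewrite lt_min e0 ltr01.
  move=> /(H _ _)[]; first by rewrite ge_min lexx orbT.
  move=> r /= r0 hr; exists r => // h /hr /le_trans; apply.
  by rewrite ler_wpM2r ?cabs_ge0// ge_min lexx.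
move=> e0; pose d := e / 10; have d0 : 0 < d by rewrite divr_gt0.
have dexp := near0_opp_ReIm (is_derive_near0 (is_derive_expR 0) d0).
have dcos := near0_opp_ReIm (is_derive_near0 (is_derive_cos 0) d0).
have dsin := near0_opp_ReIm (is_derive_near0 (is_derive_sin 0) d0).
have /cvgrPdist_le/(_ d d0)/near0_opp_ReIm cont := @continuous_expR R 0.
apply: filterS (filterI (filterI dexp dcos) (filterI dsin cont)).
move=> h [[[dexp_h _] [_ dcos_h]] [[_ dsin_h] [cont_h _]]].
have ch : `|complex.Re h| + `|complex.Im h| <= 2 * cabs h.
  by have := Re_le_cabs h; have := Im_le_cabs h; lra.
rewrite expR0 cos0 sin0 !mul1r oppr0 mul0r subr0 !normrN in dexp_h dcos_h dsin_h cont_h.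
rewrite addr0 in dsin_h.
have E2 : expR (- complex.Re h) <= 2.
  have := ler_norm (expR (- complex.Re h) - 1).
  by rewrite distrC; rewrite /d in cont_h; lra.
case: h dexp_h dcos_h dsin_h cont_h ch E2 => p q /=.
set E := expR (- p); set C := cos (- q); set S := sin (- q).
move=> dexp_h dcos_h dsin_h cont_h ch E2.
have E0 : 0 <= E by exact: expR_ge0.
have -> : cexp (- (p +i* q)) - 1 + (p +i* q) = (E * C - 1 + p) +i* (E * S + q).
  by rewrite /cexp /=; congr (_ +i* _); rewrite subr0.
apply: le_trans (cabs_le _ _) _.
have re : `|E * C - 1 + p| <= 2 * (d * `|q|) + d * `|p|.
  rewrite (_ : _ + p = E * (C - 1) + (E - 1 - - p)); last by ring.
  apply: le_trans (ler_normD _ _) (lerD _ dexp_h).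
  by rewrite normrM (ger0_norm E0) ler_pM.
have im : `|E * S + q| <= 2 * (d * `|q|) + d * `|q|.
  rewrite (_ : _ + q = E * (S - - q) + (1 - E) * q); last by ring.
  apply: le_trans (ler_normD _ _) (lerD _ _).
    by rewrite normrM (ger0_norm E0) ler_pM.
  by rewrite normrM ler_wpM2r.
apply: le_trans (lerD re im) _.
have : d * (`|p| + `|q|) <= d * (2 * cabs (p +i* q)).
  by exact: ler_wpM2l (ltW d0) _ _ ch.
have : 0 <= d * `|p| by exact: mulr_ge0 (ltW d0) _.
have -> : e = 10 * d by rewrite /d; field.
lra.
Qed.

End ComplexExponential.

(** * The analytic semigroup generated by minus the identity *)

Section ScalarAnalyticSemigroup.
Variables (R : realType) (H : hilbertSpace R).
Implicit Types (z w : R[i]) (x : H).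

Definition scalar_sg (z : R[i]^o) x : H := cexp (- z) *: x.

Lemma scalar_hnorm (c : R[i]) x : hnorm (c *: x) <= cabs c * hnorm x.
Proof. by rewrite hnormZ. Qed.

Lemma scalar_bounded (c : R[i]) : bounded_op (fun x => c *: x).
Proof.
apply: (@bounded_op_le _ _ _ (cabs c)) => [a x y|x]; last exact: scalar_hnorm.
by rewrite scalerDr !scalerA mulrC.
Qed.

Lemma scalar_sgD z w x : scalar_sg (z + w) x = scalar_sg z (scalar_sg w x).
Proof. by rewrite /scalar_sg opprD cexpD scalerA. Qed.

(** The operators are multiples of the identity, so that operator-norm
    differentiability at z is differentiability at z of the scalar function
    z -> exp(- z); by the addition formula the latter reduces to the origin. *)
Lemma scalar_sg_holomorphic z : op_holomorphic_at scalar_sg z.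
Proof.
exists (fun x => (- cexp (- z)) *: x); first exact: scalar_bounded.
pose q (h : R[i]^o) : R[i] := h^-1 * (cexp (- (z + h)) - cexp (- z)) + cexp (- z).
have qE (h : R[i]^o) : (fun x => h^-1 *: (scalar_sg (z + h) x - scalar_sg z x) -
    (- cexp (- z)) *: x) = (fun x => q h *: x).
  by apply/funext => x; rewrite /scalar_sg -scalerBl scalerA -scalerBl opprK.
under eq_fun do rewrite qE.
have q0 : cabs (q h) @[h --> (0 : R[i]^o)^'] --> (0 : R).
  apply/cvgr0Pnorm_le => e e0; pose C := cabs (cexp (- z)) + 1.
  have C0 : 0 < C by rewrite ltr_wpDl ?cabs_ge0.
  rewrite near_withinE; apply: filterS (cexpN_taylor (divr_gt0 e0 C0)) => h he /= h0.
  have h_gt0 : 0 < cabs h by rewrite -ltcR -cabsE normr_gt0.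
  have -> : q h = cexp (- z) * (h^-1 * (cexp (- h) - 1 + h)).
    by rewrite /q opprD cexpD !mulrDr mulVf//; ring.
  rewrite ger0_norm ?cabs_ge0// !cabsM.
  have hV : cabs h^-1 * cabs h = 1 by rewrite -cabsM mulVf// /cabs normr1.
  apply: (@le_trans _ _ (cabs (cexp (- z)) * (e / C))).
    rewrite ler_wpM2l ?cabs_ge0// -[leRHS]mul1r -hV -mulrA [cabs h * _]mulrC.
    by rewrite ler_wpM2l ?cabs_ge0.
  by rewrite mulrA ler_pdivrMr// mulrC; apply: ler_wpM2l (ltW e0) _ _ _; rewrite lerDl.
apply: (@squeeze_cvge _ _ _ _ (cst 0%E) _ (fun h : R[i]^o => (cabs (q h))%:E)).
- apply: nearW => h; rewrite opnorm_ge0/=; apply: opnorm_le; first exact: cabs_ge0.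
  by move=> x; exact: scalar_hnorm.
- exact: cvg_cst.
- by apply: cvg_EFin => //; apply: nearW.
Qed.

Lemma scalar_sg_cvg0 x :
  (fun z : R[i]^o => scalar_sg z x) @ nbhs (0 : R[i]^o) --> x.
Proof.
apply: cvg_hnorm.
have c1 : (fun z : R[i]^o => cabs (cexp (- z) - 1)) @ nbhs (0 : R[i]^o) --> (0 : R).
  apply/cvgr0Pnorm_le => e e0; have e2 : 0 < e / 2 by rewrite divr_gt0.
  apply: filterS (filterI (cexpN_taylor ltr01) (near0_cabs e2)) => z [z1 ze].
  rewrite ger0_norm ?cabs_ge0//.
  have -> : cexp (- z) - 1 = (cexp (- z) - 1 + z) + (- z) by ring.
  apply: le_trans (cabsD _ _) _.
  by have -> : cabs (- z) = cabs z; [rewrite /cabs normrN | lra].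
have -> : (fun z : R[i]^o => hnorm (scalar_sg z x - x)) =
    (fun z => cabs (cexp (- z) - 1) * hnorm x).
  by apply/funext => z; rewrite /scalar_sg -[X in _ - X]scale1r -scalerBl hnormZ.
by rewrite -[X in _ --> X](mul0r (hnorm x)); apply: cvgMl.
Qed.

(** The scalar semigroup extends to the whole complex plane; the right half
    plane, of half-angle pi / 2, is the largest sector that the definition admits. *)
Lemma scalar_sg_analytic (T : R -> H -> H) :
  C0_semigroup T -> (forall t x, T t x = (expR (- t))%:C *: x) ->
  analytic_semigroup T.
Proof.
move=> TC0 TE; split=> //; exists (pi / 2), scalar_sg; split.
  by rewrite lexx andbT divr_gt0 ?pi_gt0.
split.
- by move=> t x _; rewrite /scalar_sg -rmorphN cexp_real TE.
- by move=> z _; exact: scalar_bounded.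
- by move=> z w x _ _; exact: scalar_sgD.
- by move=> z _; exact: scalar_sg_holomorphic.
- by move=> d x _; apply: cvg_within_filter; exact: scalar_sg_cvg0.
Qed.

End ScalarAnalyticSemigroup.

(** * The example *)

Lemma generates_ext (R : realType) (H : hilbertSpace R) (A B : linop H)
    (T : R -> H -> H) :
  (forall x, dom A x <-> dom B x) -> (forall x, A x = B x) ->
  generates A T -> generates B T.
Proof.
move=> domAB AB [TC0 gA]; split=> // x y.
by rewrite -gA; split=> -[/domAB dx <-]; rewrite AB.
Qed.

Section Example.
Variable R : realType.

Local Notation H := (ell2_hilbert R).

Definition rate (k : nat) : R := k.+1%:R^-1.

Lemma rate_gt0 k : 0 < rate k.
Proof. by rewrite invr_gt0 ltr0n. Qed.

Lemma rate_le1 k : rate k <= 1.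
Proof. by rewrite invf_le1 ?ltr0n// ler1n. Qed.

Lemma rate01 k : 0 <= rate k <= 1.
Proof. by rewrite ltW ?rate_gt0//= rate_le1. Qed.

(** The spectrum of A + B accumulates at 0. *)
Lemma rate_small (e : R) : 0 < e -> exists k, rate k <= e.
Proof.
move=> e0; exists (Num.truncn e^-1).
rewrite -[leRHS]invrK lef_pV2 ?posrE ?invr_gt0 ?ltr0n//.
by apply/ltW/truncnS_gt.
Qed.

Lemma one_in01 (k : nat) : 0 <= (1 : R) <= 1.
Proof. by rewrite ler01 lexx. Qed.

Lemma opp1_bound (k : nat) : `|- (1 : R)| <= 1.
Proof. by rewrite normrN normr1. Qed.

Lemma pert_bound k : `|1 - rate k| <= 1.
Proof. by have /andP[? ?] := rate01 k; rewrite ger0_norm ?subr_ge0// gerBl. Qed.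

Lemma opp_rate_bound k : `|- rate k| <= 1.
Proof. exact: opp_coeff_bound rate01 k. Qed.

Definition opA : linop H := diagop opp1_bound.

(** Chosen so that A + B is the diagonal operator with entries - rate k. *)
Definition opB : linop H := diagop pert_bound.

Lemma opAB_generates : generates (linop_add opA opB) (diag_sg rate : R -> H -> H).
Proof.
apply: (@generates_ext _ _ (diagop opp_rate_bound));
  last exact: diag_sg_generates rate01 _ _.
  by move=> x; split.
move=> x.
apply: ell2_eq => k; rewrite /= (diagE _ _ opp_rate_bound).
rewrite -[RHS]/(diag (fun=> - 1) x k + diag (fun k => 1 - rate k) x k).
rewrite (diagE _ _ opp1_bound) (diagE _ _ pert_bound) -mulrDl -rmorphD.
by rewrite addrA addNr add0r.
Qed.

Lemma opB_subordinate : subordinate 0 opB opA.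
Proof.
split=> //; exists 1 => // x _; rewrite powRr0 subr0 powRr1 ?hnorm_ge0// mulr1.
exact: diag_hnorm pert_bound.
Qed.

(** The entries (1 - rate k) exp(-t) stay above exp(-t) / 2 for k >= 1. *)
Lemma opBT_not_compact (t : R) :
  ~ compact_op (fun x : H => opB (diag_sg (fun=> 1) t x)).
Proof.
pose c k := (1 - rate k) * expR (- (t * 1)).
pose M := 1 + expR (- (t * 1)).
have eM (k : nat) : `|expR (- (t * 1))| <= M by rewrite ger0_norm ?expR_ge0// lerDr.
have pM k : `|1 - rate k| <= M.
  by rewrite (le_trans (pert_bound k))// lerDl expR_ge0.
have -> : (fun x : H => opB (diag_sg (fun=> 1) t x)) = diag c.
  by apply/funext => x; exact: diagM pM eM.
apply: (@diag_not_compact _ _ (M * M) (expR (- (t * 1)) / 2)).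
- move=> k; rewrite /c normrM; apply: ler_pM => //; exact: eM k.
- by rewrite divr_gt0 ?expR_gt0.
- exists 1%N => // k /= k1; have /andP[? ?] := rate01 k.
  rewrite ger0_norm ?mulr_ge0 ?expR_ge0 ?subr_ge0// mulrC ler_wpM2r ?expR_ge0//.
  have : rate k <= 2^-1 by rewrite lef_pV2 ?posrE ?ltr0n// ler_nat.
  by move=> {eM} ?; lra.
Qed.

Lemma const_sg_exp_stable : uniformly_exp_stable (diag_sg (fun=> 1) : R -> H -> H).
Proof.
exists 1, 1; split=> // t t0; rewrite !mul1r.
apply: opnorm_le => [|x]; first exact: expR_ge0.
by apply: diag_hnorm => k; rewrite mulr1 ger0_norm ?expR_ge0.
Qed.

End Example.

Theorem mainTheorem10 (R : realType) :
  exists (H : hilbertSpace R) (A B : linop H) (T : R -> H -> H),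
    [/\ generates A T,
        analytic_semigroup T,
        uniformly_exp_stable T,
        dom B = dom A &
        [/\ exists2 theta : R, 0 <= theta < 1 & subordinate theta B A,
            forall t : R, 0 < t -> ~ compact_op (fun x => B (T t x)) &
            exists S : R -> H -> H,
              [/\ generates (linop_add A B) S,
                  strongly_stable S &
                  ~ uniformly_exp_stable S]]].
Proof.
exists (ell2_hilbert R), (opA R), (opB R), (diag_sg (fun=> 1)); split=> //.
- exact: diag_sg_generates (@one_in01 R) _ _.
- apply: scalar_sg_analytic; first exact: diag_sg_C0 (@one_in01 R).
  by move=> t x; rewrite /diag_sg mulr1; exact: diag_const.
- exact: const_sg_exp_stable.
split.
- by exists 0; [rewrite lexx ltr01|exact: opB_subordinate].
- by move=> t _; exact: opBT_not_compact.
- exists (diag_sg (@rate R)); split.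
  + exact: opAB_generates.
  + exact: diag_sg_strongly_stable (@rate01 R) (@rate_gt0 R).
  + exact: diag_sg_not_exp_stable (@rate01 R) (@rate_small R).
Qed.
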